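(* Let $(Z_k)_{0\le k\le n}$ be a Markov chain with values in measurable spaces $(E_k,\mathcal E_k)$, let $\mathbf Z_k=(Z_0,\dots,Z_k)$ be its trajectories, with values in $\mathbf E_k=E_0\times\cdots\times E_k$, let $\nu_k$ be the distribution of $\mathbf Z_k$, let $h:\mathbf E_n\to\mathbb R$ be bounded and measurable, and let $p_h=\mathbb E[h(\mathbf Z_n)]$. For a set of potential functions $G=(G_k)_{0\le k\le n-1}$, let $\sigma^2_{IPS,G}$ be the asymptotic variance of the interacting particle system (IPS) estimator of $p_h$ (potential functions and $\sigma^2_{IPS,G}$ are defined in the context). For $k=0,\dots,n-1$, let $g_k:\mathbf E_k\to[0,+\infty)$ be defined by $$g_k(\mathbf z_k)=\mathbb E\Big[\,\mathbb E\big[h(\mathbf Z_n)\,\big|\,\mathbf Z_{k+1}\big]^2\,\Big|\,\mathbf Z_k=\mathbf z_k\Big].$$ For $k=0,\dots,n-1$, let $G_k^*:\mathbf E_k\to[0,+\infty)$ be defined, for $\mathbf z_k=(z_{k,0},\dots,z_{k,k})$ and with $\mathbf z_{k-1}=(z_{k,0},\dots,z_{k,k-1})$, by $$G_k^*(\mathbf z_k)=\sqrt{\frac{g_k(\mathbf z_k)}{g_{k-1}(\mathbf z_{k-1})}}\quad\text{if } g_{k-1}(\mathbf z_{k-1})>0,\qquad G_k^*(\mathbf z_k)=0\quad\text{otherwise},$$ with the convention $g_{-1}=1$. Then the potential functions minimizing $\sigma^2_{IPS,G}$ are the $G_k^*$, $k\le n-1$. They are unique in the sense that they are defined up to a multiplicative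 constant, $\nu_k$-almost surely. The optimal variance of the IPS method with $n$ steps is then $$\sigma^2_{IPS,G^*}=\mathbb E\Big[\mathbb E\big[h(\mathbf Z_n)\big|\mathbf Z_0\big]^2\Big]-p_h^2+\sum_{k=1}^{n}\left\{\mathbb E\left[\sqrt{\mathbb E\Big[\mathbb E\big[h(\mathbf Z_n)\big|\mathbf Z_k\big]^2\,\Big|\,\mathbf Z_{k-1}\Big]}\,\right]^2-p_h^2\right\}.$$
   Context: The chain $(Z_k)_{0\le k\le n}$ has an initial law on $E_0$ and transition kernels $Q_k$, i.e. $\mathbb E[f(Z_k)\mid Z_{k-1}]=\int_{E_k}f(z_k)\,Q_k(dz_k\mid Z_{k-1})$ for $k>0$ and $f$ bounded measurable. The space $\mathbf E_k$ carries the product $\sigma$-algebra, and $(\mathbf Z_k)_{0\le k\le n}$ is itself a Markov chain. A set of potential functions is a family $G=(G_s)_{0\le s<n}$ of functions $G_s:\mathbf E_s\to[0,+\infty)$ such that $\mathbb E\big[\prod_{s=0}^{n-1}G_s(\mathbf Z_s)\big]>0$. The IPS method with $N$ particles and multinomial resampling simulates trajectories with the original Markov dynamics, alternating propagation steps with selection steps in which trajectories are resampled with probabilities proportional to the potentials $G_k$; it produces an estimator $\hat p_h$ of $p_h$. When the potential functions are positive-valued, $\sqrt N(\hat p_h-p_h)$ converges in distribution as $N\to\infty$ to a centered Gaussian with variance $$\sigma^2_{IPS,G}=\sum_{k=0}^{n}\left\{\mathbb E\Big[\prod_{i=0}^{k-1}G_i(\mathbf Z_i)\Big]\;\mathbb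 E\Big[\mathbb E[h(\mathbf Z_n)\mid\mathbf Z_k]^2\prod_{s=0}^{k-1}G_s^{-1}(\mathbf Z_s)\Big]-p_h^2\right\},$$ where empty products ($k=0$) equal $1$. The quantity $\sigma^2_{IPS,G}$ in the claim is the one given by this formula; where a product of potentials in the second expectation vanishes together with the factor $\mathbb E[h(\mathbf Z_n)\mid\mathbf Z_k]^2$, the quotient is read as $0$. Families $G$ and $G'$ with $G_k=a_kG'_k$ for constants $a_k>0$, or with $G_k(\mathbf Z_k)=G'_k(\mathbf Z_k)$ almost surely, give the same value of $\sigma^2_{IPS,G}$.
   Formalization: Assumes P(h(Z_n)≠0)>0 and, for k+1≤n-1, that a.s. g_k(Z_k)=0 implies g_{k+1}(Z_{k+1})=0 (otherwise G* is not a minimizing family of potentials); uniqueness is asserted ν_k-a.s. only where g_{k-1}(z_{k-1})>0, since G_k is arbitrary elsewhere. *)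

(* Defs.v *)
From HB Require Import structures.
From mathcomp Require Import all_boot all_order all_algebra.
From mathcomp Require Import all_classical all_reals all_analysis.

Set Implicit Arguments.
Unset Strict Implicit.
Unset Printing Implicit Defensive.

Import Order.TTheory GRing.Theory Num.Theory.

Local Open Scope classical_set_scope.
Local Open Scope ring_scope.

Section Trajectories.
Context (d : nat -> measure_display) (E : forall k, measurableType (d k)).

Fixpoint trajSpace_display (k : nat) : measure_display :=
  if k is j.+1 then measure_prod_display (trajSpace_display j, d j.+1) else d 0%N.

(* E_0 * ... * E_k, left-nested, with the product sigma-algebra: for
   z : trajSpace k.+1, z.1 is the trajectory up to time k and z.2 the state at
   time k.+1. *)
Fixpoint trajSpace (k : nat) : measurableType (trajSpace_display k) :=
  match k return measurableType (trajSpace_display k) with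
  | 0%N => E 0%N
  | j.+1 => (trajSpace j * E j.+1)%type
  end.

Definition traj_last (k : nat) : trajSpace k -> E k :=
  match k return trajSpace k -> E k with
  | 0%N => fun z => z
  | j.+1 => fun z => z.2
  end.

Fixpoint traj (Omega : Type) (Z : forall k, Omega -> E k) (k : nat)
    (w : Omega) : trajSpace k :=
  match k return trajSpace k with
  | 0%N => Z 0%N w
  | j.+1 => (traj Z j w, Z j.+1 w)
  end.

End Trajectories.

(* phi : S -> R is a version of x |-> E[Y | X = x].  Conditional expectations
   are only determined almost surely, so they are handled through this
   predicate rather than through one particular choice of version. *)
Definition is_cond_exp (R : realType) (dO dS : measure_display)
    (Omega : measurableType dO) (S : measurableType dS)
    (P : probability Omega R) (X : Omega -> S) (Y : Omega -> R)
    (phi : S -> R) : Prop :=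
  [/\ P.-integrable setT (EFin \o Y),
      measurable_fun setT phi,
      P.-integrable setT (EFin \o (phi \o X)) &
      forall A : set S, measurable A ->
        (\int[P]_(w in X @^-1` A) (phi (X w))%:E =
         \int[P]_(w in X @^-1` A) (Y w)%:E)%E].

Section IPS.
Context (R : realType) (dO : measure_display) (Omega : measurableType dO)
  (P : probability Omega R)
  (d : nat -> measure_display) (E : forall k, measurableType (d k))
  (Z : forall k, Omega -> E k) (n : nat).

(* Only the times 0, ..., n are constrained; E k, Z k and Q k are irrelevant
   for larger indices. *)
Definition is_markov_chain (Q : forall k, R.-pker (E k) ~> (E k.+1)) : Prop :=
  (forall k, (k <= n)%N -> measurable_fun setT (Z k)) /\
  (forall k, (k < n)%N -> forall f : E k.+1 -> R,
     measurable_fun setT f -> (exists M : R, forall x, `|f x| <= M) ->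
     is_cond_exp P (traj Z k) (f \o Z k.+1)
       (fun z => \int[Q k (traj_last z)]_(x in setT) f x)).

Definition traj_law (k : nat) : set (trajSpace E k) -> \bar R :=
  pushforward P (traj Z k).

Definition potential_prod (G : forall s, trajSpace E s -> R) (k : nat)
    (w : Omega) : R :=
  \prod_(s < k) G s (traj Z s w).

Definition is_potential (G : forall s, trajSpace E s -> R) : Prop :=
  [/\ forall s, (s < n)%N -> measurable_fun setT (G s),
      forall s, (s < n)%N -> forall z, 0 <= G s z &
      (0 < 'E_P[potential_prod G n])%E].

(* m k stands for z |-> E[h(Z_0, ..., Z_n) | (Z_0, ..., Z_k) = z].
   The quotient is taken in \bar R, where 0^-1 = +oo and 0 * +oo = 0: it is 0
   when the product of potentials and the numerator both vanish, and +oo when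
   only the product of potentials vanishes. *)
Definition ips_variance (h : trajSpace E n -> R) (m : forall k, trajSpace E k -> R)
    (G : forall s, trajSpace E s -> R) : \bar R :=
  (\sum_(0 <= k < n.+1)
     ('E_P[potential_prod G k] *
      \int[P]_w (((m k (traj Z k w)) ^+ 2)%:E / (potential_prod G k w)%:E)
      - 'E_P[h \o traj Z n] ^+ 2))%E.

Definition ips_minimizer (h : trajSpace E n -> R) (m : forall k, trajSpace E k -> R)
    (G : forall s, trajSpace E s -> R) : Prop :=
  is_potential G /\
  forall G' : forall s, trajSpace E s -> R, is_potential G' ->
    (ips_variance h m G <= ips_variance h m G')%E.

(* g_{k-1}, as a function of z_k through z_{k-1}, with g_{-1} = 1 *)
Definition g_pred (g : forall k, trajSpace E k -> R) (k : nat) : trajSpace E k -> R :=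
  match k return trajSpace E k -> R with
  | 0%N => fun=> 1
  | j.+1 => fun z => g j z.1
  end.

Definition G_star (g : forall k, trajSpace E k -> R) (k : nat) (z : trajSpace E k) : R :=
  if 0 < g_pred g z then Num.sqrt (g k z / g_pred g z) else 0.

End IPS.

Arguments traj_law {R dO Omega} P {d E} Z k _.
Arguments G_star {R d E} g k z.

(* Main.v *)
Require Import Defs.
From HB Require Import structures.
From mathcomp Require Import all_boot all_order all_algebra.
From mathcomp Require Import all_classical all_reals all_analysis.
From mathcomp Require Import measurable_realfun.
From mathcomp Require Import ring lra.

(** Write [W_k] for the product of the potentials before time [k]. Since
    [W_(k+1)] is a function of the trajectory up to time [k], conditioning gives
    [E[m_(k+1)^2 / W_(k+1)] = E[g_k / W_(k+1)]], and Cauchy-Schwarz yields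
    [E[W_(k+1)] E[g_k / W_(k+1)] >= E[sqrt g_k]^2], with equality iff [W_(k+1)]
    is almost surely proportional to [sqrt g_k]. The products of the [G_star]
    telescope to [sqrt g_k], so they attain all these bounds at once. For any
    other minimizer every bound is an equality (the optimal terms are finite),
    and its potentials are recovered as quotients of consecutive [W_k]. *)

Import Order.TTheory GRing.Theory Num.Theory.

Local Open Scope classical_set_scope.
Local Open Scope ring_scope.

Set Implicit Arguments.
Unset Strict Implicit.

(** * Integration against versions of a conditional expectation *)

Section cond_exp.
Context (R : realType) (dO dS : measure_display) (Omega : measurableType dO)
  (S : measurableType dS) (P : probability Omega R).
Implicit Types (X : Omega -> S) (Y : Omega -> R).
Import HBNNSimple.

Lemma ge0_integral_nnsfun_comp X Y (f : {nnsfun S >-> R}) :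
  measurable_fun setT X -> measurable_fun setT Y -> (forall w, 0 <= Y w) ->
  (\int[P]_w ((Y w)%:E * (f (X w))%:E) =
   \sum_(y \in range f)
     (y%:E * \int[P]_(w in X @^-1` (f @^-1` [set y])) (Y w)%:E))%E.
Proof.
move=> mX mY Y0.
have mA y : measurable (X @^-1` (f @^-1` [set y])).
  by rewrite -[_ @^-1` _]setTI; apply: mX => //; exact: measurable_sfunP.
transitivity (\int[P]_w \sum_(y \in range f)
    (y%:E * ((EFin \o Y) \_ (X @^-1` (f @^-1` [set y]))) w))%E.
  apply: eq_integral => w _; rewrite (fimfunE f (X w)) -fsumEFin//.
  rewrite ge0_mule_fsumr; last by move=> y; exact: nnfun_muleindic_ge0.
  apply: eq_fsbigr => y _; rewrite patchE indicE.
  have -> : (w \in X @^-1` (f @^-1` [set y])) = (X w \in f @^-1` [set y]).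
    by apply/idP/idP; rewrite !inE.
  case: ifPn => _ /=; last by rewrite mulr0 !mule0.
  by rewrite mulr1 muleC.
have mYA y : measurable_fun setT
    ((EFin \o Y) \_ (X @^-1` (f @^-1` [set y])) : Omega -> \bar R).
  apply/(measurable_restrictT _ _).1 => //.
  by apply/measurable_funTS/measurable_EFinP.
have YA0 y w : (0 <= ((EFin \o Y) \_ (X @^-1` (f @^-1` [set y]))) w)%E.
  by apply: erestrict_ge0 => ? _; rewrite lee_fin.
rewrite (@ge0_integral_fsum _ _ _ P _ measurableT _ (fun y w =>
  (y%:E * ((EFin \o Y) \_ (X @^-1` (f @^-1` [set y]))) w)%E))//; last 2 first.
- by move=> y; exact: measurable_funeM.
(* Nonnegativity is required for every real [y]; for [y < 0] the level set is empty since [f >= 0],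
   so the term is 0. *)
- move=> y w _; have [y0|y0] := leP 0 y; first by rewrite mule_ge0 ?lee_fin.
  rewrite patchE memNset ?mule0//= => fXw.
  by move: y0; rewrite -fXw ltNge fun_ge0.
apply: eq_fsbigr => y /set_mem [x _ <-].
rewrite ge0_integralZl//; first by rewrite -integral_mkcond.
by rewrite lee_fin fun_ge0.
Qed.

(** Simple functions first, then monotone convergence. The weight [f] is extended-valued because it
    will be the inverse of a product of potentials, which is [+oo] where the product vanishes. *)
Lemma ge0_integral_cond_exp X Y (phi : S -> R) (f : S -> \bar R) :
  measurable_fun setT X -> is_cond_exp P X Y phi ->
  (forall w, 0 <= Y w) -> (forall x, 0 <= phi x) ->
  measurable_fun setT f -> (forall x, (0 <= f x)%E) ->
  (\int[P]_w ((Y w)%:E * f (X w)) =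
   \int[P]_w ((phi (X w))%:E * f (X w)))%E.
Proof.
move=> mX [iY mphi iphi eqA] Y0 phi0 mf f0.
have mY : measurable_fun setT Y by apply/measurable_EFinP; case/integrableP: iY.
pose h := nnsfun_approx measurableT mf.
(* Stated for a general [V] so as to serve both for [Y] and for [phi \o X]: the two integrals are
   then limits of one and the same sequence. *)
have key (V : Omega -> R) : measurable_fun setT V -> (forall w, 0 <= V w) ->
    (\int[P]_w ((V w)%:E * (h n (X w))%:E) @[n --> \oo] -->
     \int[P]_w ((V w)%:E * f (X w)))%E.
  move=> mV V0.
  have fE w : ((V w)%:E * f (X w) =
      lim ((V w)%:E * (h n (X w))%:E @[n --> \oo]))%E.
    apply/esym/cvg_lim => //; apply: cvgeZl => //.
    exact: cvg_nnsfun_approx.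
  under eq_integral do rewrite fE.
  apply: cvg_monotone_convergence => //.
  - move=> n; apply/measurable_EFinP/measurable_funM => //.
    by apply: measurableT_comp => //; exact/measurable_funP.
  - by move=> n w _; rewrite -EFinM lee_fin mulr_ge0.
  - move=> w _ a b ab; rewrite lee_wpmul2l ?lee_fin//.
    exact/lefP/nd_nnsfun_approx.
have mphiX : measurable_fun setT (phi \o X) by exact: measurableT_comp.
apply: cvg_unique (key Y mY Y0) _ => //.
suff -> : (fun n => \int[P]_w ((Y w)%:E * (h n (X w))%:E))%E =
    (fun n => \int[P]_w (((phi \o X) w)%:E * (h n (X w))%:E))%E.
  by apply: key => // w; exact: phi0.
apply/funext => n; rewrite !ge0_integral_nnsfun_comp//; last first.
  by move=> w; exact: phi0.
by apply: eq_fsbigr => y _; rewrite eqA//; exact: measurable_sfunP.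
Qed.

(** The nonnegative function [g - f] has integral 0 over [D], hence vanishes almost everywhere
    there, although it is positive on all of [D]. *)
Lemma eq_integral_lt_null (D : set Omega) (f g : Omega -> R) : measurable D ->
  P.-integrable setT (EFin \o f) -> P.-integrable setT (EFin \o g) ->
  (\int[P]_(w in D) (f w)%:E = \int[P]_(w in D) (g w)%:E)%E ->
  (forall w, D w -> f w < g w) -> P D = 0%E.
Proof.
move=> mD iF iG eqI lt.
have iF' := integrableS measurableT mD (@subsetT _ D) iF.
have iG' := integrableS measurableT mD (@subsetT _ D) iG.
have I0 : (\int[P]_(w in D) ((g w)%:E - (f w)%:E) = 0)%E.
  rewrite integralB_EFin// eqI subee//.
  exact: (integrable_fin_num mD iG').
have m : measurable_fun D (fun w => (g w)%:E - (f w)%:E)%E.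
  apply: emeasurable_funB; [by case/integrableP: iG'|by case/integrableP: iF'].
have := (ae_eq_integral_abs P mD m).1.
have -> : (\int[P]_(w in D) `|(g w)%:E - (f w)%:E| = 0)%E.
  rewrite -[RHS]I0; apply: eq_integral => w /set_mem Dw.
  by rewrite gee0_abs// -EFinB lee_fin subr_ge0 ltW// lt.
move=> /(_ erefl) [N [mN N0 sub]]; apply/eqP; rewrite eq_le measure_ge0 andbT.
rewrite -N0 le_measure ?inE// => w Dw; apply: sub => /= /(_ Dw) /eqP.
by rewrite -EFinB eqe subr_eq0 gt_eqF// lt.
Qed.

(** On the preimage of [phi > M], and likewise of [phi < - M], [Y] and [phi \o X] have equal
    integrals while one is strictly below the other, so both preimages are null. *)
Lemma is_cond_exp_le X Y phi (M : R) : measurable_fun setT X ->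
  is_cond_exp P X Y phi -> (forall w, `|Y w| <= M) ->
  {ae P, forall w, `|phi (X w)| <= M}.
Proof.
move=> mX [iY mphi iphi eqA] YM.
pose A := [set x | M < phi x]; pose B := [set x | phi x < - M].
have mA : measurable A.
  by rewrite -[A]setTI; apply: measurable_fun_ltr.
have mB : measurable B.
  by rewrite -[B]setTI; apply: measurable_fun_ltr.
have mX' C : measurable C -> measurable (X @^-1` C).
  by move=> mC; rewrite -[_ @^-1` _]setTI; exact: mX.
have A0 : P (X @^-1` A) = 0%E.
  apply: (@eq_integral_lt_null _ Y (phi \o X)) => //; [exact: mX'| |].
    by rewrite -eqA.
  by move=> w /= Aw; apply: le_lt_trans Aw; exact: le_trans (ler_norm _) (YM w).
have B0 : P (X @^-1` B) = 0%E.
  apply: (@eq_integral_lt_null _ (phi \o X) Y) => //; [exact: mX'| |].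
    by rewrite -eqA.
  move=> w /= Bw; apply: lt_le_trans Bw _.
  by have := YM w; rewrite ler_norml => /andP[].
apply: (@negligibleS _ _ _ P (X @^-1` A `|` X @^-1` B)); last first.
  by apply: negligibleU; apply/negligibleP => //; exact: mX'.
move=> w /= /negP; rewrite ler_norml negb_and -!ltNge => /orP[]; [by right|by left].
Qed.

(** Same argument with the sets [f < phi] and [phi < f]; it serves to identify [m n] with [h] along
    the trajectories. *)
Lemma is_cond_exp_comp X (f phi : S -> R) : measurable_fun setT X ->
  measurable_fun setT f ->
  is_cond_exp P X (f \o X) phi -> {ae P, forall w, phi (X w) = f (X w)}.
Proof.
move=> mX mf [iY mphi iphi eqA].
pose A := [set x | f x < phi x]; pose B := [set x | phi x < f x].
have mA : measurable A by rewrite -[A]setTI; apply: measurable_fun_ltr.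
have mB : measurable B by rewrite -[B]setTI; apply: measurable_fun_ltr.
have mX' C : measurable C -> measurable (X @^-1` C).
  by move=> mC; rewrite -[_ @^-1` _]setTI; exact: mX.
have A0 : P (X @^-1` A) = 0%E.
  apply: (@eq_integral_lt_null _ (f \o X) (phi \o X)) => //; first exact: mX'.
  by rewrite -eqA.
have B0 : P (X @^-1` B) = 0%E.
  apply: (@eq_integral_lt_null _ (phi \o X) (f \o X)) => //; first exact: mX'.
  by rewrite -eqA.
apply: (@negligibleS _ _ _ P (X @^-1` A `|` X @^-1` B)); last first.
  by apply: negligibleU; apply/negligibleP => //; exact: mX'.
move=> w /= /eqP; rewrite neq_lt => /orP[]; [by right|by left].
Qed.

End cond_exp.

(** * Measurability of inverses and square roots, through real powers *)

Lemma ge0_measurable_inve (R : realType) (d : measure_display)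
    (T : measurableType d) (f : T -> R) :
  measurable_fun setT f -> (forall x, 0 <= f x) ->
  measurable_fun setT (fun x => (f x)%:E^-1)%E.
Proof.
move=> mf f0.
rewrite (_ : (fun x => _) =
    (fun x => if f x == 0 then +oo%E else (f x `^ (-1))%:E)); last first.
  by apply/funext => x; rewrite inver powR_inv1.
apply: measurable_fun_ifT => //; first exact: measurable_fun_eqr.
by apply/measurable_EFinP; exact: (measurableT_comp (measurable_powR (-1)) mf).
Qed.

Lemma ge0_measurable_inv (R : realType) (d : measure_display)
    (T : measurableType d) (f : T -> R) :
  measurable_fun setT f -> (forall x, 0 <= f x) ->
  measurable_fun setT (fun x => (f x)^-1).
Proof.
move=> mf f0.
rewrite (_ : (fun x => _) = (fun x => f x `^ (-1))); last first.
  by apply/funext => x; rewrite powR_inv1.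
exact: (measurableT_comp (measurable_powR (-1)) mf).
Qed.

Lemma ge0_measurable_sqrt (R : realType) (d : measure_display)
    (T : measurableType d) (f : T -> R) :
  measurable_fun setT f -> (forall x, 0 <= f x) ->
  measurable_fun setT (fun x => Num.sqrt (f x)).
Proof.
move=> mf f0.
rewrite (_ : (fun x => _) = (fun x => f x `^ (2^-1))); last first.
  by apply/funext => x; rewrite powR12_sqrt.
exact: (measurableT_comp (measurable_powR 2^-1) mf).
Qed.

(** * Cauchy-Schwarz with a weight that may vanish, and its equality case *)

Section weighted_cauchy_schwarz.
Context (R : realType) (d : measure_display) (T : measurableType d)
  (mu : {measure set T -> \bar R}).

Lemma ae_le_eq_integral (f g : T -> R) :
  mu.-integrable setT (EFin \o f) -> mu.-integrable setT (EFin \o g) ->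
  {ae mu, forall x, f x <= g x} ->
  (\int[mu]_x (g x)%:E <= \int[mu]_x (f x)%:E)%E ->
  {ae mu, forall x, f x = g x}.
Proof.
move=> iF iG fg gf.
have m : measurable_fun setT (fun x => (g x)%:E - (f x)%:E)%E.
  by apply: emeasurable_funB; [case/integrableP: iG|case/integrableP: iF].
have I0 : (\int[mu]_x `|(g x)%:E - (f x)%:E| = 0)%E.
  apply/eqP; rewrite eq_le integral_ge0// andbT.
  have -> : (\int[mu]_x `|(g x)%:E - (f x)%:E| =
             \int[mu]_x ((g x)%:E - (f x)%:E))%E.
    apply: ae_eq_integral => //; first exact: measurableT_comp.
    apply: filterS fg => x fgx _.
    by rewrite gee0_abs// -EFinB lee_fin subr_ge0.
  by rewrite integralB_EFin// sube_le0.
have := (ae_eq_integral_abs mu measurableT m).1 I0.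
apply: filterS => x /(_ I)/eqP.
by rewrite -EFinB eqe subr_eq0 => /eqP.
Qed.

Variables (W s : T -> R).
Hypotheses (mW : measurable_fun setT W) (W0 : forall x, 0 <= W x)
  (s0 : forall x, 0 <= s x) (iS : mu.-integrable setT (EFin \o s))
  (intS_gt0 : (0 < \int[mu]_x (s x)%:E)%E)
  (intW_gt0 : (0 < \int[mu]_x (W x)%:E)%E).

(** Same convention as in [ips_variance]: where [W] vanishes, [q] is 0 if [s] vanishes too and [+oo]
    otherwise. *)
Let q x := ((s x ^+ 2)%:E / (W x)%:E)%E.

Let ms : measurable_fun setT s.
Proof. by apply/measurable_EFinP; case/integrableP: iS. Qed.

Let mq : measurable_fun setT q.
Proof.
apply: emeasurable_funM; last exact: ge0_measurable_inve.
by apply/measurable_EFinP; exact: measurable_funX.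
Qed.

Let q0 x : (0 <= q x)%E.
Proof. by rewrite mule_ge0 ?lee_fin ?sqr_ge0// inve_ge0 lee_fin. Qed.

(** The inverse of the finite number [W x] is never 0, so [q = 0] almost everywhere would force
    [s = 0] almost everywhere. *)
Let intq_gt0 : (0 < \int[mu]_x q x)%E.
Proof.
rewrite lt_neqAle integral_ge0// andbT eq_sym; apply/eqP => intq0.
have /(ae_eq_integral_abs mu measurableT mq).1 qae : (\int[mu]_x `|q x| = 0)%E.
  by rewrite -intq0; apply: eq_integral => x _; rewrite gee0_abs.
move: intS_gt0; rewrite (_ : (\int[mu]_x _ = 0)%E) ?ltxx//.
rewrite -(integral0 mu setT); apply: ge0_ae_eq_integral => //.
- by case/integrableP: iS.
- by move=> x _; rewrite lee_fin.
apply: filterS qae => x /(_ I)/eqP + _.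
rewrite mule_eq0 inve_eq0 orbF eqe sqrf_eq0 => /eqP -> //.
Qed.

(* For t > 0, AM-GM gives 2 s <= t W + s^2 / (t W) pointwise; integrate with
   t = (\int s) / (\int W). *)
Lemma weighted_cauchy_schwarz :
  ((\int[mu]_x (s x)%:E) ^+ 2 <=
     (\int[mu]_x (W x)%:E) * \int[mu]_x ((s x ^+ 2)%:E / (W x)%:E))%E /\
  (((\int[mu]_x (W x)%:E) * \int[mu]_x ((s x ^+ 2)%:E / (W x)%:E) <=
     (\int[mu]_x (s x)%:E) ^+ 2)%E ->
   exists2 l : R, 0 < l & {ae mu, forall x, W x = l * s x}).
Proof.
rewrite -/(q _).
have cfin : (\int[mu]_x (s x)%:E)%E \is a fin_num.
  exact: (integrable_fin_num measurableT iS).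
(* If one factor is infinite, the other is positive and the product is [+oo]: the bound is trivial,
   and equality is excluded because the integral of [s] is finite. *)
have [aoo|afin] := eqVneq (\int[mu]_x (W x)%:E)%E +oo%E.
  rewrite aoo gt0_mulye// leey; split => //.
  by rewrite -(fineK cfin) -EFin_expe leye_eq.
have [boo|bfin] := eqVneq (\int[mu]_x q x)%E +oo%E.
  rewrite boo gt0_muley// leey; split => //.
  by rewrite -(fineK cfin) -EFin_expe leye_eq.
pose u x := s x ^+ 2 / W x.
have u0 x : 0 <= u x by rewrite divr_ge0// sqr_ge0.
have m_u : measurable_fun setT u.
  apply: measurable_funM; first exact: measurable_funX.
  exact: ge0_measurable_inv.
have iq : mu.-integrable setT q.
  apply/integrableP; split => //.
  under eq_integral do rewrite gee0_abs//.
  by rewrite ltey.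
(* A finite integral makes [q] finite almost everywhere, which excludes [W = 0 < s]. Hence [q]
   agrees almost everywhere with the real quotient [u], where division by 0 gives 0. *)
have Ws : {ae mu, forall x, W x = 0 -> s x = 0}.
  apply: filterS (integrable_ae measurableT iq) => x /(_ I) qfin Wx0.
  apply/eqP/negPn/negP => sx0; move: qfin.
  rewrite /q Wx0 inve0 gt0_muley// lte_fin lt_neqAle sqr_ge0 andbT.
  by rewrite eq_sym sqrf_eq0.
have uq : (\int[mu]_x (u x)%:E = \int[mu]_x q x)%E.
  apply: ge0_ae_eq_integral => //; first exact/measurable_EFinP.
    by move=> x _; rewrite lee_fin.
  apply: filterS Ws => x Wsx _; rewrite /u /q inver.
  case: eqP => [Wx0|_]; last by rewrite -EFinM.
  by rewrite Wsx// expr0n/= !mul0r mul0e.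
have iW : mu.-integrable setT (EFin \o W).
  apply/integrableP; split; first exact/measurable_EFinP.
  under eq_integral do rewrite gee0_abs ?lee_fin//.
  by rewrite ltey.
have iu : mu.-integrable setT (EFin \o u).
  apply/integrableP; split; first exact/measurable_EFinP.
  under eq_integral do rewrite gee0_abs ?lee_fin//.
  by rewrite uq ltey.
rewrite -uq.
have := integrable_fin_num measurableT iW; have := integrable_fin_num measurableT iu.
move: intS_gt0 intW_gt0 cfin.
case Ec : (\int[mu]_x (s x)%:E)%E => [c| |]//; rewrite lte_fin => c_gt0.
case Ea : (\int[mu]_x (W x)%:E)%E => [a| |]//; rewrite lte_fin => a_gt0 _.
case Eb : (\int[mu]_x (u x)%:E)%E => [b| |]// _ _.
pose t := c / a; have t_gt0 : 0 < t by rewrite divr_gt0.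
pose f x := t * W x + t^-1 * u x.
have itW : mu.-integrable setT (EFin \o (fun x => t * W x)).
  exact: (integrableZl measurableT t iW).
have itu : mu.-integrable setT (EFin \o (fun x => t^-1 * u x)).
  exact: (integrableZl measurableT t^-1 iu).
have i2s : mu.-integrable setT (EFin \o (fun x => 2 * s x)).
  exact: (integrableZl measurableT 2 iS).
have if_ : mu.-integrable setT (EFin \o f).
  exact: (integrableD measurableT itW itu).
have If : (\int[mu]_x (f x)%:E = (t * a + t^-1 * b)%:E)%E.
  rewrite (integralD_EFin measurableT itW itu) EFinD !EFinM -Ea -Eb.
  by rewrite -(integralZl measurableT iW) -(integralZl measurableT iu).
have I2s : (\int[mu]_x (2 * s x)%:E = (2 * c)%:E)%E.
  by under eq_integral do rewrite EFinM; rewrite integralZl// Ec.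
(* The AM-GM defect is a square over a positive number: it gives the inequality, and where it is 0
   it gives [t * W x = s x]. *)
have fE x : 0 < W x -> f x - 2 * s x = (t * W x - s x) ^+ 2 / (t * W x).
  move=> Wx; rewrite /f /u; field; rewrite ?gt_eqF//.
have sf : {ae mu, forall x, 2 * s x <= f x}.
  apply: filterS Ws => x; have := W0 x; rewrite le_eqVlt => /orP[/eqP Wx|Wx _].
    by move=> /(_ (esym Wx)) sx; rewrite /f /u -Wx sx expr0n/= mul0r !mulr0 addr0.
  by rewrite -subr_ge0 fE// divr_ge0 ?sqr_ge0// mulr_ge0// ltW.
split.
  have : (\int[mu]_x (2 * s x)%:E <= \int[mu]_x (f x)%:E)%E.
    apply: ae_ge0_le_integral => //.
    - by move=> x _; rewrite lee_fin mulr_ge0.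
    - by case/integrableP: i2s.
    - by move=> x _; rewrite lee_fin addr_ge0// mulr_ge0// ?invr_ge0 ltW.
    - by case/integrableP: if_.
    - by apply: filterS sf => x ? _; rewrite lee_fin.
  rewrite I2s If lee_fin -EFin_expe -EFinM lee_fin.
  have -> : t * a + t^-1 * b = c + a * b / c by rewrite /t; field; rewrite !gt_eqF.
  move=> H; have : c <= a * b / c by lra.
  by rewrite ler_pdivlMr.
rewrite -EFin_expe -EFinM lee_fin => abc.
(* Equality of the integrals makes AM-GM an equality almost everywhere, that is [t W = s], whence
   the factor [t^-1]. *)
exists t^-1; first by rewrite invr_gt0.
have : {ae mu, forall x, 2 * s x = f x}.
  apply: ae_le_eq_integral => //.
  rewrite I2s If lee_fin.
  have -> : t * a + t^-1 * b = c + a * b / c by rewrite /t; field; rewrite !gt_eqF.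
  have : a * b / c <= c by rewrite ler_pdivrMr.
  lra.
apply: filterS2 Ws => x Wsx sfx.
have := W0 x; rewrite le_eqVlt => /orP[/eqP Wx|Wx].
  by rewrite Wsx// mulr0.
have := fE x Wx; rewrite -sfx subrr => /esym/eqP.
rewrite mulf_eq0 invr_eq0 sqrf_eq0 (gt_eqF (mulr_gt0 t_gt0 Wx)) orbF subr_eq0.
by move=> /eqP <-; rewrite mulrA mulVf ?mul1r// gt_eqF.
Qed.

End weighted_cauchy_schwarz.

Unset Implicit Arguments.

(** The terms other than [k] can be cancelled because their [F]-sum is finite and at most their
    [G]-sum; the values of [G] may be infinite. *)
Lemma lee_sum_ord_eq (R : realType) (N : nat) (F G : nat -> \bar R) :
  (forall k, (k < N)%N -> F k \is a fin_num) ->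
  (forall k, (k < N)%N -> (F k <= G k)%E) ->
  (\sum_(k < N) G k <= \sum_(k < N) F k)%E ->
  forall k, (k < N)%N -> (G k <= F k)%E.
Proof.
move=> Ffin FG GF k kN.
move: GF; rewrite (bigD1 (Ordinal kN))//= [leRHS](bigD1 (Ordinal kN))//=.
set SG := (\sum_(i < N | _) G i)%E; set SF := (\sum_(i < N | _) F i)%E.
have SFfin : SF \is a fin_num by apply/sum_fin_numP => i _ _; exact: Ffin.
have SFG : (SF <= SG)%E by apply: lee_sum => i _; exact: FG.
by move=> H; rewrite -(leeD2rE _ _ SFfin) (le_trans _ H)// leeD2l.
Qed.

(** * Trajectories and products of potentials *)

Section ips.
Context (R : realType) (dO : measure_display) (Omega : measurableType dO)
  (P : probability Omega R) (n : nat)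
  (d : nat -> measure_display) (E : forall k, measurableType (d k))
  (Z : forall k, Omega -> E k).
Hypothesis mZ : forall k, (k <= n)%N -> measurable_fun setT (Z k).

Lemma measurable_traj k : (k <= n)%N -> measurable_fun setT (traj Z k).
Proof.
elim: k => [|k IH] kn; first exact: mZ.
by apply: measurable_fun_pair; [apply: IH; exact: ltnW|exact: mZ].
Qed.

Lemma measurable_comp_traj k (f : trajSpace E k -> R) : (k <= n)%N ->
  measurable_fun setT f -> measurable_fun setT (fun w => f (traj Z k w)).
Proof. by move=> kn mf; apply: measurableT_comp => //; exact: measurable_traj. Qed.

(* W_(k+1) = G_0 ... G_k depends on the trajectory up to time k only. *)
Fixpoint traj_prod (G : forall s, trajSpace E s -> R) (k : nat)
    {struct k} : trajSpace E k -> R :=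
  match k return trajSpace E k -> R with
  | 0%N => G 0%N
  | j.+1 => fun z => traj_prod G j z.1 * G j.+1 z
  end.

Lemma potential_prod0 G w : potential_prod Z G 0 w = 1 :> R.
Proof. by rewrite /potential_prod big_ord0. Qed.

Lemma potential_prodS G k w :
  potential_prod Z G k.+1 w = potential_prod Z G k w * G k (traj Z k w) :> R.
Proof. by rewrite /potential_prod big_ord_recr. Qed.

Lemma traj_prodE G k w :
  traj_prod G k (traj Z k w) = potential_prod Z G k.+1 w.
Proof.
elim: k => [|k IH] /=; first by rewrite potential_prodS potential_prod0 mul1r.
by rewrite IH (potential_prodS _ k.+1).
Qed.

Section potential.
Variable G : forall s, trajSpace E s -> R.
Hypotheses (mG : forall s, (s < n)%N -> measurable_fun setT (G s))
  (G0 : forall s, (s < n)%N -> forall z, 0 <= G s z).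

Lemma traj_prod_ge0 k z : (k < n)%N -> 0 <= traj_prod G k z.
Proof.
elim: k z => [|k IH] z kn /=; first exact: G0.
by apply: mulr_ge0; [apply: IH; exact: ltnW|exact: G0].
Qed.

Lemma measurable_traj_prod k : (k < n)%N -> measurable_fun setT (traj_prod G k).
Proof.
elim: k => [|k IH] kn; first exact: (mG _ kn).
apply: measurable_funM; last exact: (mG _ kn).
by apply: (@measurableT_comp _ _ _ _ _ _ (traj_prod G k)) => //; exact/IH/ltnW.
Qed.

Lemma potential_prod_ge0 k w : (k <= n)%N -> 0 <= potential_prod Z G k w.
Proof.
case: k => [_|k kn]; first by rewrite potential_prod0.
by rewrite -traj_prodE traj_prod_ge0.
Qed.

Lemma measurable_potential_prod k : (k <= n)%N ->
  measurable_fun setT (potential_prod Z G k).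
Proof.
case: k => [_|k kn].
  rewrite (_ : potential_prod Z G 0 = cst 1); first exact: measurable_cst.
  by apply/funext => w; rewrite potential_prod0.
rewrite (_ : potential_prod Z G k.+1 = fun w => traj_prod G k (traj Z k w));
  last by apply/funext => w; rewrite traj_prodE.
by apply: measurable_comp_traj; [exact: ltnW|exact: measurable_traj_prod].
Qed.

(** The product up to [k] is a factor of the product up to [n]; if it vanished almost surely, so
    would the latter. *)
Lemma expectation_potential_prod_gt0 k : (k <= n)%N ->
  (0 < 'E_P[potential_prod Z G n])%E -> (0 < 'E_P[potential_prod Z G k])%E.
Proof.
move=> kn; rewrite unlock => Wn; rewrite lt_neqAle integral_ge0 ?andbT; last first.
  by move=> w _; rewrite lee_fin potential_prod_ge0.
apply/eqP => /esym Wk0.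
have mW j : (j <= n)%N -> measurable_fun setT (EFin \o potential_prod Z G j).
  by move=> jn; apply/measurable_EFinP; exact: measurable_potential_prod.
have /(ae_eq_integral_abs P measurableT (mW _ kn)).1 ae0 :
    (\int[P]_w `|(potential_prod Z G k w)%:E| = 0)%E.
  rewrite -Wk0; apply: eq_integral => w _.
  by rewrite gee0_abs// lee_fin potential_prod_ge0.
move: Wn; rewrite (_ : (\int[P]_w _ = 0)%E) ?ltxx//.
rewrite -(integral0 P setT); apply: ge0_ae_eq_integral => //.
- exact: mW.
- by move=> w _; rewrite lee_fin potential_prod_ge0.
apply: filterS ae0 => w /(_ I) [Wk] _; congr EFin.
have := Wk; rewrite /potential_prod.
rewrite -!(big_mkord xpredT (fun s => G s (traj Z s w))).
by rewrite (@big_cat_nat _ _ _ k 0%N n)//= => ->; rewrite mul0r.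
Qed.

(** The product at index [k.+1] involves only the potentials at times 0 to [k], so its inverse is a
    function of [traj Z k] and passes through the conditioning. *)
Lemma integral_cond_exp_potential_prod k (Y : Omega -> R)
    (phi : trajSpace E k -> R) : (k < n)%N ->
  is_cond_exp P (traj Z k) Y phi ->
  (forall w, 0 <= Y w) -> (forall z, 0 <= phi z) ->
  (\int[P]_w ((Y w)%:E / (potential_prod Z G k.+1 w)%:E) =
   \int[P]_w ((phi (traj Z k w))%:E / (potential_prod Z G k.+1 w)%:E))%E.
Proof.
move=> kn HY Y0 phi0.
under eq_integral do rewrite -traj_prodE.
under [RHS]eq_integral do rewrite -traj_prodE.
apply: (@ge0_integral_cond_exp _ _ _ _ _ P (traj Z k) Y phi
  (fun z => (traj_prod G k z)%:E^-1%E)) => //.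
- exact/measurable_traj/ltnW.
- by apply: ge0_measurable_inve; [exact: measurable_traj_prod|
    move=> z; exact: traj_prod_ge0].
- by move=> z; rewrite inve_ge0 lee_fin traj_prod_ge0.
Qed.

End potential.

(** * The functions [g] and the lower bound for each variance term *)

Variables (h : trajSpace E n -> R).
Hypotheses (h_meas : measurable_fun setT h)
  (h_bounded : exists M : R, forall z, `|h z| <= M).
Variable m : forall k, trajSpace E k -> R.
Hypothesis Hm : forall k, (k <= n)%N ->
  is_cond_exp P (traj Z k) (h \o traj Z n) (m k).
Variable g : forall k, trajSpace E k -> R.
Hypotheses (g_ge0 : forall k, (k < n)%N -> forall z, 0 <= g k z)
  (Hg : forall k, (k < n)%N ->
    is_cond_exp P (traj Z k) (fun w => m k.+1 (traj Z k.+1 w) ^+ 2) (g k))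
  (h_neq0 : (0 < P [set w | h (traj Z n w) != 0%R])%E)
  (g_absorbing : forall k, (k.+1 < n)%N ->
    {ae P, forall w, g k (traj Z k w) = 0 -> g k.+1 (traj Z k.+1 w) = 0}).

Lemma measurable_g k : (k < n)%N -> measurable_fun setT (g k).
Proof. by move=> kn; case: (Hg k kn). Qed.

Lemma measurable_m k : (k <= n)%N -> measurable_fun setT (m k).
Proof. by move=> kn; case: (Hm k kn). Qed.

(** A bound on [h] passes to [m 0] almost surely. *)
Lemma integral_m0_sqr_fin_num :
  (\int[P]_w ((m 0%N (traj Z 0%N w)) ^+ 2)%:E)%E \is a fin_num.
Proof.
have [M hM] := h_bounded.
rewrite ge0_fin_numE; last by apply: integral_ge0 => w _; rewrite lee_fin sqr_ge0.
apply: (@le_lt_trans _ _ (\int[P]_w (M ^+ 2)%:E)%E).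
  apply: ae_ge0_le_integral => //.
  - by move=> w _; rewrite lee_fin sqr_ge0.
  - apply/measurable_EFinP/measurable_funX/measurable_comp_traj => //.
    exact: measurable_m.
  - by move=> w _; rewrite lee_fin sqr_ge0.
  have mM := is_cond_exp_le (measurable_traj 0%N (leq0n n)) (Hm 0%N (leq0n n))
    (fun w => hM (traj Z n w)).
  apply: filterS mM => w mwM _; rewrite lee_fin -real_normK ?num_real//.
  by rewrite lerXn2r ?nnegrE// (le_trans _ mwM).
by rewrite integral_cst//= probability_setT mule1 ltry.
Qed.

(** Up to a factor, the optimal product of potentials at index [k.+1]. *)
Let sqrtg k w := Num.sqrt (g k (traj Z k w)).

Lemma measurable_sqrtg k : (k < n)%N -> measurable_fun setT (sqrtg k).
Proof.
move=> kn; apply: ge0_measurable_sqrt => [|w]; last exact: g_ge0.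
by apply: measurable_comp_traj; [exact: ltnW|exact: measurable_g].
Qed.

(** Domination by the integrable [1 + g k]. *)
Lemma integrable_sqrtg k : (k < n)%N -> P.-integrable setT (EFin \o sqrtg k).
Proof.
move=> kn; have [_ _ ig _] := Hg k kn.
have i1 : P.-integrable setT (EFin \o (fun w => 1 + g k (traj Z k w))).
  exact: (integrableD measurableT
    (finite_measure_integrable_cst P 1 measurableT) ig).
apply: le_integrable i1 => //.
  by apply/measurable_EFinP; exact: measurable_sqrtg.
move=> w _ /=; have g0 := g_ge0 k kn (traj Z k w).
rewrite lee_fin !ger0_norm ?sqrtr_ge0 ?addr_ge0// /sqrtg.
have := sqr_sqrtr g0; have := sqrtr_ge0 (g k (traj Z k w)).
set s := Num.sqrt _ => s0 <-; nra.
Qed.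

Lemma sqrtg_sqr k w : (k < n)%N -> sqrtg k w ^+ 2 = g k (traj Z k w).
Proof. by move=> kn; rewrite sqr_sqrtr// g_ge0. Qed.

(** By [g_absorbing], zeros propagate forward in time up to the last index. *)
Lemma ae_g_eq0_last k : (k < n)%N -> {ae P, forall w, g k (traj Z k w) = 0} ->
  {ae P, forall w, g n.-1 (traj Z n.-1 w) = 0}.
Proof.
move=> kn g0.
suff : forall j, (k + j < n)%N ->
    {ae P, forall w, g (k + j)%N (traj Z (k + j)%N w) = 0}.
  move=> /(_ (n.-1 - k)%N); rewrite subnKC; last first.
    by rewrite -ltnS prednK// (leq_ltn_trans _ kn).
  by apply; rewrite prednK// (leq_ltn_trans _ kn).
elim=> [|j IH]; first by rewrite addn0.
rewrite addnS => kjn; apply: filterS2 (g_absorbing _ kjn) (IH (ltnW kjn)).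
by move=> w; apply.
Qed.

(** Otherwise [g k], hence [g n.-1], vanishes almost surely; then [m n] has second moment 0, and
    since it equals [h] on trajectories this contradicts [h_neq0]. *)
Lemma integral_sqrtg_gt0 k : (k < n)%N -> (0 < \int[P]_w (sqrtg k w)%:E)%E.
Proof.
move=> kn; have n0 : (0 < n)%N by exact: leq_ltn_trans kn.
have n1n : (n.-1 < n)%N by rewrite prednK.
rewrite lt_neqAle integral_ge0 ?andbT; last first.
  by move=> w _; rewrite lee_fin sqrtr_ge0.
apply/eqP => /esym s0.
have ms : measurable_fun setT (EFin \o sqrtg k).
  by apply/measurable_EFinP; exact: measurable_sqrtg.
have /(ae_eq_integral_abs P measurableT ms).1 ae0 :
    (\int[P]_w `|(sqrtg k w)%:E| = 0)%E.
  by rewrite -s0; apply: eq_integral => w _; rewrite gee0_abs// lee_fin sqrtr_ge0.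
have {ae0}g0 : {ae P, forall w, g n.-1 (traj Z n.-1 w) = 0}.
  apply: (ae_g_eq0_last k kn); apply: filterS ae0 => w /(_ I) [] sw.
  by rewrite -(sqrtg_sqr _ _ kn) sw expr0n.
have m0 : {ae P, forall w, m n (traj Z n w) = 0}.
  have [im _ _ /(_ setT measurableT)] := Hg n.-1 n1n.
  rewrite preimage_setT (_ : (\int[P]_w (g n.-1 (traj Z n.-1 w))%:E = 0)%E); last first.
    rewrite -(integral0 P setT); apply: ge0_ae_eq_integral => //.
    - apply/measurable_EFinP/measurable_comp_traj; first exact: ltnW.
      exact: measurable_g.
    - by move=> w _; rewrite lee_fin g_ge0.
    - by apply: filterS g0 => w -> _.
  rewrite prednK// in im * => /esym im0.
  have /(ae_eq_integral_abs P measurableT (measurable_int _ im)).1 :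
      (\int[P]_w `|(m n (traj Z n w) ^+ 2)%:E| = 0)%E.
    rewrite -[RHS]im0; apply: eq_integral => w _.
    by rewrite gee0_abs// lee_fin sqr_ge0.
  by apply: filterS => w /(_ I) [] /eqP; rewrite sqrf_eq0 => /eqP.
have hm := is_cond_exp_comp (measurable_traj _ (leqnn n)) h_meas (Hm _ (leqnn n)).
move: h_neq0; rewrite (_ : P _ = 0%E) ?ltxx//.
apply/negligibleP.
  have -> : [set w | h (traj Z n w) != 0] = ~` ((h \o traj Z n) @^-1` [set 0]).
    by apply/seteqP; split => w /= /eqP.
  apply: measurableC; rewrite -[_ @^-1` _]setTI.
  by apply: measurable_comp_traj => //.
apply: negligibleS (filterI hm m0) => w /= /eqP hw [hmw mw].
by apply: hw; rewrite -hmw.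
Qed.

(** Conditioning replaces the squared [m k.+1] by [g k], the square of [sqrtg k]; Cauchy-Schwarz
    then applies with the product of potentials as weight. *)
Lemma variance_term_bound G k : (k < n)%N -> is_potential P Z n G ->
  let V := ('E_P[potential_prod Z G k.+1] *
    \int[P]_w ((m k.+1 (traj Z k.+1 w) ^+ 2)%:E / (potential_prod Z G k.+1 w)%:E))%E in
  ('E_P[sqrtg k] ^+ 2 <= V)%E /\
  ((V <= 'E_P[sqrtg k] ^+ 2)%E -> exists2 l : R, 0 < l &
    {ae P, forall w, potential_prod Z G k.+1 w = l * sqrtg k w}).
Proof.
move=> kn [mG G0 EG] /=.
rewrite (integral_cond_exp_potential_prod _ mG G0 _ _ _ kn (Hg k kn)); last 2 first.
- by move=> w; exact: sqr_ge0.
- exact: g_ge0.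
under eq_integral do rewrite -sqrtg_sqr//.
have := expectation_potential_prod_gt0 _ mG G0 _ kn EG; rewrite unlock => EG'.
apply: weighted_cauchy_schwarz => //.
- exact: measurable_potential_prod.
- by move=> w; exact: potential_prod_ge0.
- by move=> w; exact: sqrtr_ge0.
- exact: integrable_sqrtg.
- exact: integral_sqrtg_gt0.
Qed.

(** * The potentials [G_star] and the bounds they attain *)

Lemma measurable_g_pred k : (k <= n)%N -> measurable_fun setT (@g_pred R d E g k).
Proof.
case: k => [_|k kn] /=; first exact: measurable_cst.
by apply: (@measurableT_comp _ _ _ _ _ _ (g k)) => //; exact: measurable_g.
Qed.

Lemma g_pred_ge0 k z : (k <= n)%N -> 0 <= @g_pred R d E g k z.
Proof. by case: k z => [z _|k z kn] //=; exact: g_ge0. Qed.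

Lemma measurable_G_star k : (k < n)%N -> measurable_fun setT (G_star g k).
Proof.
move=> kn; have kn' := ltnW kn.
apply: measurable_fun_ifT => //.
  by apply: measurable_fun_ltr => //; exact: measurable_g_pred.
apply: ge0_measurable_sqrt => [|z]; last by rewrite divr_ge0 ?g_ge0 ?g_pred_ge0.
apply: measurable_funM; first exact: measurable_g.
apply: ge0_measurable_inv => [|z]; last exact: g_pred_ge0.
exact: measurable_g_pred.
Qed.

Lemma G_star_ge0 k z : 0 <= G_star g k z.
Proof. by rewrite /G_star; case: ifP => // _; exact: sqrtr_ge0. Qed.

(** Absorption restated with [g_pred]; at time 0 it is vacuous, as [g_pred] is then 1. *)
Lemma ae_g_pred_eq0 k : (k < n)%N ->
  {ae P, forall w, g_pred g (traj Z k w) = 0 -> g k (traj Z k w) = 0}.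
Proof.
case: k => [_|k kn]; last exact: g_absorbing.
by apply: aeW => w /= /eqP; rewrite oner_eq0.
Qed.

Lemma potential_prod_G_star k : (k <= n)%N ->
  {ae P, forall w,
    potential_prod Z (G_star g) k w = Num.sqrt (g_pred g (traj Z k w))}.
Proof.
elim: k => [_|k IH kn].
  by apply: aeW => w; rewrite potential_prod0 /= sqrtr1.
apply: filterS2 (IH (ltnW kn)) (ae_g_pred_eq0 k kn) => w Wk gk0.
rewrite potential_prodS Wk /G_star /=.
(* Where [g_pred] vanishes the product is already 0, and absorption makes the next square root 0 as
   well; elsewhere the quotient telescopes. *)
have := g_pred_ge0 k (traj Z k w) (ltnW kn); rewrite le_eqVlt => /orP[/eqP gp|gp].
  by rewrite -gp ltxx mulr0 gk0 ?sqrtr0.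
rewrite gp -sqrtrM ?(ltW gp)//; congr Num.sqrt.
by rewrite mulrC divfK// gt_eqF.
Qed.

Lemma expectation_G_star k : (k < n)%N ->
  ('E_P[potential_prod Z (G_star g) k.+1] = 'E_P[sqrtg k])%E.
Proof.
move=> kn; rewrite unlock; apply: ge0_ae_eq_integral => //.
- apply/measurable_EFinP/measurable_potential_prod => // s sn.
  exact: measurable_G_star.
- by apply/measurable_EFinP; exact: measurable_sqrtg.
- move=> w _; rewrite lee_fin potential_prod_ge0// => s _ z; exact: G_star_ge0.
- by move=> w _; rewrite lee_fin sqrtr_ge0.
- by apply: filterS (potential_prod_G_star _ kn) => w -> _.
Qed.

Lemma is_potential_G_star : is_potential P Z n (G_star g).
Proof.
split; first exact: measurable_G_star.
  by move=> s _ z; exact: G_star_ge0.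
(* For [n = 0] the empty product has expectation 1; otherwise the expectation is that of
   [sqrtg n.-1]. *)
case En : n => [|k].
  rewrite unlock; under eq_integral do rewrite potential_prod0.
  by rewrite integral_cst//= probability_setT mule1 lte01.
have kn : (k < n)%N by rewrite En.
by rewrite expectation_G_star// unlock; exact: integral_sqrtg_gt0.
Qed.

Lemma variance_term_G_star k : (k < n)%N ->
  ('E_P[potential_prod Z (G_star g) k.+1] *
    \int[P]_w ((m k.+1 (traj Z k.+1 w) ^+ 2)%:E /
               (potential_prod Z (G_star g) k.+1 w)%:E) =
   'E_P[sqrtg k] ^+ 2)%E.
Proof.
move=> kn; have [mG G0 _] := is_potential_G_star.
rewrite (integral_cond_exp_potential_prod _ mG G0 _ _ _ kn (Hg k kn)); last 2 first.
- by move=> w; exact: sqr_ge0.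
- exact: g_ge0.
rewrite expectation_G_star//; congr (_ * _)%E; rewrite unlock.
have mg : measurable_fun setT (fun w => g k (traj Z k w)).
  by apply: measurable_comp_traj; [exact: ltnW|exact: measurable_g].
apply: ge0_ae_eq_integral => //.
- apply: emeasurable_funM; first exact/measurable_EFinP.
  apply: ge0_measurable_inve; first exact: measurable_potential_prod.
  by move=> w; exact: potential_prod_ge0.
- by apply/measurable_EFinP; exact: measurable_sqrtg.
- move=> w _; rewrite mule_ge0 ?lee_fin ?g_ge0// inve_ge0 lee_fin.
  exact: potential_prod_ge0.
- by move=> w _; rewrite lee_fin sqrtr_ge0.
apply: filterS (potential_prod_G_star _ kn) => w Wk _.
rewrite Wk -[g_pred g _]/(g k (traj Z k w)) -/(sqrtg k w) -sqrtg_sqr// inver.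
(* Where [sqrtg k] vanishes, the extended quotient is 0 times [+oo], that is 0, so it equals
   [sqrtg k] there too. *)
case: eqP => [->|/eqP s0]; first by rewrite expr0n /= mul0e.
by rewrite -EFinM expr2 mulfK.
Qed.

(** * Comparison of the variances term by term *)

Let p := 'E_P[h \o traj Z n]%E.

Lemma p_fin_num : p \is a fin_num.
Proof.
rewrite /p unlock; have [ih _ _ _] := Hm 0%N (leq0n n).
exact: integrable_fin_num ih.
Qed.

Let variance_term G k :=
  ('E_P[potential_prod Z G k] *
      \int[P]_w (((m k (traj Z k w)) ^+ 2)%:E / (potential_prod Z G k w)%:E)
      - p ^+ 2)%E.

(** The product at index 0 is empty, so this term is the same for all potentials. *)
Lemma variance_term0 G :
  variance_term G 0 = ('E_P[(fun w => m 0%N (traj Z 0%N w) ^+ 2)%R] - p ^+ 2)%E.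
Proof.
rewrite /variance_term unlock; congr (_ - _)%E.
under eq_integral do rewrite potential_prod0.
rewrite integral_cst//= probability_setT !mul1e.
by apply: eq_integral => w _; rewrite potential_prod0 inve1 mule1.
Qed.

(** Finiteness is what later allows cancelling the optimal terms in [lee_sum_ord_eq]. *)
Lemma variance_term_fin_num k : (k <= n)%N ->
  variance_term (G_star g) k \is a fin_num.
Proof.
have p2 : (- p ^+ 2)%E \is a fin_num by rewrite fin_numN fin_numX// p_fin_num.
case: k => [_|k kn].
  by rewrite variance_term0 fin_numD p2 unlock integral_m0_sqr_fin_num.
rewrite /variance_term variance_term_G_star// fin_numD p2 andbT fin_numX// unlock.
exact: (integrable_fin_num measurableT (integrable_sqrtg _ kn)).
Qed.

Lemma variance_term_le G k : is_potential P Z n G -> (k <= n)%N ->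
  (variance_term (G_star g) k <= variance_term G k)%E.
Proof.
move=> HG; case: k => [_|k kn]; first by rewrite !variance_term0.
rewrite {1}/variance_term variance_term_G_star//; apply: leeD2r.
by have [] := variance_term_bound G k kn HG.
Qed.

Lemma ips_varianceE G :
  ips_variance P Z h m G = (\sum_(k < n.+1) variance_term G k)%E.
Proof. by rewrite /ips_variance big_mkord. Qed.

Lemma ips_minimizer_G_star : ips_minimizer P Z h m (G_star g).
Proof.
split; first exact: is_potential_G_star.
move=> G HG; rewrite !ips_varianceE; apply: lee_sum => k _.
by apply: variance_term_le => //; rewrite -ltnS.
Qed.

Lemma ips_variance_G_star : ips_variance P Z h m (G_star g) =
  ('E_P[(fun w => m 0%N (traj Z 0%N w) ^+ 2)%R] - p ^+ 2 +
   \sum_(1 <= k < n.+1)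
     ('E_P[(fun w => Num.sqrt (g k.-1 (traj Z k.-1 w)))%R] ^+ 2 - p ^+ 2))%E.
Proof.
rewrite /ips_variance big_ltn// -/(variance_term (G_star g) 0) variance_term0.
congr (_ + _)%E; apply: eq_big_nat => -[//|k] /andP[_ kn].
by rewrite -/(variance_term (G_star g) k.+1) /variance_term variance_term_G_star.
Qed.

(** * Uniqueness of the minimizing potentials *)

Lemma minimizer_potential_prod G : ips_minimizer P Z h m G ->
  forall k, (k <= n)%N -> exists2 l : R, 0 < l &
    {ae P, forall w,
      potential_prod Z G k w = l * Num.sqrt (g_pred g (traj Z k w))}.
Proof.
move=> [HG /(_ _ is_potential_G_star)]; rewrite !ips_varianceE => le_sum.
case=> [_|k kn].
  by exists 1 => //; apply: aeW => w; rewrite potential_prod0 /= sqrtr1 mulr1.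
have [_] := variance_term_bound G k kn HG; apply.
(* Each term of [G] is at least the optimal one and the total is no larger, so no single term
   exceeds its bound and the equality case of Cauchy-Schwarz applies. *)
have := lee_sum_ord_eq _ n.+1 (variance_term (G_star g)) (variance_term G)
  variance_term_fin_num
  (fun k => variance_term_le G k HG) le_sum k.+1 kn.
rewrite /variance_term variance_term_G_star// leeD2rE//.
by rewrite fin_numN fin_numX// p_fin_num.
Qed.

(** [G k] is the quotient of the products at [k.+1] and [k], so the constant is the quotient of
    their factors. Where [g_pred] is 0, the product at [k] vanishes almost surely and the quotient
    determines nothing, hence the restriction. *)
Lemma minimizer_unique G : ips_minimizer P Z h m G -> forall k, (k < n)%N ->
  exists2 a : R, 0 < a &
    {ae traj_law P Z k, forall z, 0 < g_pred g z -> G k z = a * G_star g k z}.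
Proof.
move=> HG k kn; have [[mG _ _] _] := HG.
have [l l0 Wk] := minimizer_potential_prod G HG k (ltnW kn).
have [l' l'0 WkS] := minimizer_potential_prod G HG k.+1 kn.
exists (l' / l); first exact: divr_gt0.
(* The exceptional set is taken in trajectory space, where it has to be measurable; its [traj_law]
   is the probability of its preimage. *)
pose A := [set z | 0 < @g_pred R d E g k z] `&`
  [set z | G k z != l' / l * G_star g k z].
have mA : measurable A.
  apply: measurableI.
    rewrite -[X in measurable X]setTI; apply: measurable_fun_ltr => //.
    exact/measurable_g_pred/ltnW.
  rewrite (_ : [set z | _] = ~` [set z | G k z == l' / l * G_star g k z]); last first.
    by apply/seteqP; split => z /= /negP.
  apply: measurableC; rewrite -[X in measurable X]setTI.
  apply: measurable_fun_eqr => //; first exact: mG.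
  by apply: measurable_funM => //; exact: measurable_G_star.
exists A; split => //; last first.
  by move=> z /= /not_implyP[gz /eqP Gz].
rewrite /traj_law /pushforward; apply/negligibleP.
  by rewrite -[X in measurable X]setTI; apply: measurable_traj => //; exact: ltnW.
apply: negligibleS (filterI Wk WkS) => w /= [gw /eqP Gw] [Wkw WkSw]; apply: Gw.
move: WkSw; rewrite potential_prodS Wkw /G_star gw /= => H.
have sg : 0 < Num.sqrt (g_pred g (traj Z k w)) by rewrite sqrtr_gt0.
apply: (mulfI (lt0r_neq0 (mulr_gt0 l0 sg))); rewrite H.
rewrite sqrtrM ?g_ge0// sqrtrV ?ltW//.
by field; rewrite !gt_eqF.
Qed.

End ips.

Theorem theorem3 (R : realType)
  (dO : measure_display) (Omega : measurableType dO) (P : probability Omega R)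
  (n : nat)
  (d : nat -> measure_display) (E : forall k, measurableType (d k))
  (Z : forall k, Omega -> E k)
  (Q : forall k, R.-pker (E k) ~> (E k.+1))
  (HZ : is_markov_chain P Z n Q)
  (h : trajSpace E n -> R)
  (h_meas : measurable_fun setT h)
  (h_bounded : exists M : R, forall z, `|h z| <= M)
  (* m k z = E[h(Z_0, ..., Z_n) | (Z_0, ..., Z_k) = z] *)
  (m : forall k, trajSpace E k -> R)
  (Hm : forall k, (k <= n)%N -> is_cond_exp P (traj Z k) (h \o traj Z n) (m k))
  (g : forall k, trajSpace E k -> R)
  (g_ge0 : forall k, (k < n)%N -> forall z, 0 <= g k z)
  (Hg : forall k, (k < n)%N ->
    is_cond_exp P (traj Z k) (fun w => m k.+1 (traj Z k.+1 w) ^+ 2) (g k))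
  (* Nondegeneracy: if n > 0, G_star is a minimizing family of potentials only
     if these two hold; the second one is automatic when h >= 0. *)
  (h_neq0 : (0 < P [set w | h (traj Z n w) != 0%R])%E)
  (g_absorbing : forall k, (k.+1 < n)%N ->
    {ae P, forall w, g k (traj Z k w) = 0 -> g k.+1 (traj Z k.+1 w) = 0}) :
  [/\ ips_minimizer P Z h m (G_star g),
      forall G, ips_minimizer P Z h m G -> forall k, (k < n)%N ->
        exists2 a : R, 0 < a &
          {ae traj_law P Z k, forall z, 0 < g_pred g z ->
            G k z = a * G_star g k z} &
      ips_variance P Z h m (G_star g) =
        ('E_P[(fun w => m 0%N (traj Z 0%N w) ^+ 2)%R] - 'E_P[h \o traj Z n] ^+ 2 +
         \sum_(1 <= k < n.+1)
           ('E_P[(fun w => Num.sqrt (g k.-1 (traj Z k.-1 w)))%R] ^+ 2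
            - 'E_P[h \o traj Z n] ^+ 2))%E].
Proof.
have [mZ _] := HZ.
split.
- exact: ips_minimizer_G_star.
- exact: minimizer_unique.
- exact: ips_variance_G_star.
Qed.
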